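(* Let $k$ be a field of characteristic $p> 0$, and let $d_1, \ldots, d_n, a$ be positive integers such that $d_i \le p^a$ for $i=1, \ldots, n-2$. Let $A=k[x_1, \ldots, x_n]/(x_1^{d_1}, \ldots, x_n^{d_n})$ and, for a positive integer $b$, let \[ B_b=k[x_1, \ldots, x_n]/(x_1^{d_1}, \ldots, x_{n-2}^{d_{n-2}}, x_{n-1}^{d_{n-1}+bp^a}, x_n^{d_n+bp^a}). \] Then for every positive integer $b$: if $B_b$ has the weak Lefschetz property, then $A$ has the weak Lefschetz property. If, in addition, $d_{n-1}+d_n\ge\sum_{i=1}^{n-2}(d_i-1)$, then for every positive integer $b$, $A$ has the weak Lefschetz property if and only if $B_b$ does.
   Context: Algebras are graded by degree, $A=\bigoplus_{i\ge0}A_i$. A graded artinian algebra $A$ has the weak Lefschetz property if there is a linear form $\ell\in A_1$ such that for every $i$ the map $A_i\to A_{i+1}$, $a\mapsto \ell a$, is injective or surjective. *)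

(* Defs.v *)
From HB Require Import structures.
From mathcomp Require Import all_boot all_algebra.
From mathcomp Require Import mpoly.
Set Implicit Arguments. Unset Strict Implicit. Unset Printing Implicit Defensive.
Import GRing.Theory.
Local Open Scope ring_scope.

(* Variables x_1,...,x_n are 'X_0,...,'X_(n-1) (0-based indices).
   [mci_ideal D f] : f lies in the ideal (x_0^(D 0), ..., x_(n-1)^(D (n-1)))
   of k[x_0,...,x_(n-1)]. *)
Definition mci_ideal (k : fieldType) (n : nat) (D : nat -> nat)
    (f : {mpoly k[n]}) : Prop :=
  exists h : 'I_n -> {mpoly k[n]}, f = \sum_(i < n) h i * 'X_i ^+ D i.

(* Weak Lefschetz property of the graded artinian algebra
   A = k[x_0..x_(n-1)] / (x_i^(D i)).  Since the ideal is homogeneous,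
   A_i = R_i / I_i with R_i the degree-i forms; a linear form of A is the
   class of a degree-1 form l.  Multiplication by l : A_i -> A_(i+1) is
   injective iff  (l f in I -> f in I) for every degree-i form f, and
   surjective iff every degree-(i+1) form g is congruent mod I to l f
   for some degree-i form f. *)
Definition mult_injective (k : fieldType) (n : nat) (D : nat -> nat)
    (l : {mpoly k[n]}) (i : nat) : Prop :=
  forall f : {mpoly k[n]}, f \is i.-homog ->
    mci_ideal D (l * f) -> mci_ideal D f.

Definition mult_surjective (k : fieldType) (n : nat) (D : nat -> nat)
    (l : {mpoly k[n]}) (i : nat) : Prop :=
  forall g : {mpoly k[n]}, g \is i.+1.-homog ->
    exists2 f : {mpoly k[n]}, f \is i.-homog & mci_ideal D (g - l * f).

Definition has_WLP (k : fieldType) (n : nat) (D : nat -> nat) : Prop :=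
  exists2 l : {mpoly k[n]}, l \is 1.-homog &
    forall i : nat, mult_injective D l i \/ mult_surjective D l i.

Definition expB (n : nat) (d : nat -> nat) (p a b : nat) : nat -> nat :=
  fun i => if (i < n - 2)%N then d i else (d i + b * p ^ a)%N.

(* Main.v *)
Require Import Defs.
From HB Require Import structures.
From mathcomp Require Import all_boot all_algebra.
From mathcomp Require Import mpoly ring zify.
Set Implicit Arguments.
Unset Strict Implicit.
Unset Printing Implicit Defensive.
Import GRing.Theory.
Local Open Scope ring_scope.

(** Let q = p^a, let x, y be the last two variables, with exponents c, e in A,
    let J be the ideal of the powers of the other variables, and N = bq.  The
    torus and a degeneration argument reduce both properties to the linear form
    l = sum of the variables.  Since d_i <= q, the Frobenius gives
    y^N = (-1)^b x^N modulo J + (l), and y is regular modulo J + (l).  Hence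
    multiplication by y^N relates the maps of A in degree i and of B_b in degree
    i + N: injectivity and surjectivity always descend from B_b to A.  They
    ascend when i + 1 < c + e (injectivity) or when i + 1 is at least
    t = sum of the (d_i - 1), i <= n - 2 (surjectivity).  If c + e >= t, the
    remaining degrees are handled by Poincare duality of A: past the middle
    degree injectivity implies surjectivity, before it the converse holds. *)

(** * Coefficients of homogeneous components and of products *)

Section Coefficients.
Variables (k : fieldType) (n : nat).
Implicit Types (f g h : {mpoly k[n]}) (m : 'X_{1..n}).

Lemma mcoeff_filter f (P : pred 'X_{1..n}) m :
  (\sum_(m' <- msupp f | P m') f@_m' *: 'X_[m'])@_m = if P m then f@_m else 0.
Proof.
rewrite raddf_sum /= -big_filter.
under eq_bigr => m' _ do rewrite mcoeffZ mcoeffX.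
have [Hm|Hm] := boolP (m \in [seq m' <- msupp f | P m']).
  rewrite (bigD1_seq m) //= ?filter_uniq ?msupp_uniq // eqxx mulr1.
  rewrite big1 ?addr0; last by move=> j /negPf ->; rewrite mulr0.
  by move: Hm; rewrite mem_filter => /andP [->].
rewrite big_seq big1 => [|j Hj]; last first.
  case: eqP => [E|_]; last by rewrite mulr0.
  by move: Hj Hm; rewrite E => ->.
move: Hm; rewrite mem_filter; case: (P m) => //= Hm.
by rewrite memN_msupp_eq0.
Qed.

Lemma mcoeff_pihomog (mf : measure n) i f m :
  (pihomog mf i f)@_m = if mf m == i then f@_m else 0.
Proof. by rewrite pihomogE mcoeff_filter. Qed.

Lemma mcoeffMX_le f m0 m :
  (f * 'X_[m0])@_m = if (m0 <= m)%MM then f@_(m - m0) else 0.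
Proof.
case: ifP => H; first by rewrite -{1}(submK H) addmC mcoeffMX.
rewrite mcoeffM big1 // => -[k1 k2] /= /eqP E.
rewrite mcoeffX; case: eqP => [E2|_]; last by rewrite mulr0.
by have := lem_addl (bmnm k1) (bmnm k2); rewrite -E -E2 H.
Qed.

(** The measure is arbitrary because two gradings occur: the degree [mdeg], and later the degree in
    a subset of the variables. *)
Lemma pihomogM (mf : measure n) i j f g :
  g \is i.-homog for mf -> pihomog mf (i + j) (g * f) = g * pihomog mf j f.
Proof.
move=> Hg; elim/mpolyind: f => [|c m f _ _ IH].
  by rewrite mulr0 !pihomog0 mulr0.
rewrite mulrDr !pihomogD mulrDr IH; congr (_ + _).
rewrite -scalerAr !linearZ /= -scalerAr pihomogX; congr (_ *: _).
case: eqP => [E|/eqP E]; first by rewrite pihomog_dE // dhomogM // dhomogX E.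
rewrite mulr0 (@pihomog_ne0 _ _ _ (i + mf m)%N) //.
  by rewrite eqn_add2l.
by rewrite dhomogM // dhomogX.
Qed.

Lemma mcoeff_lin (c : 'I_n -> k) f m :
  ((\sum_i c i *: 'X_i) * f)@_m =
  \sum_i (if m i == 0%N then 0 else c i * f@_(m - U_(i))).
Proof.
rewrite mulr_suml raddf_sum /=; apply: eq_bigr => i _.
rewrite -scalerAl mcoeffZ [_ * f]mulrC mcoeffMX_le lep1mP.
by case: (m i == 0%N); rewrite ?mulr0.
Qed.

End Coefficients.

(** * Ideals generated by powers of some of the variables *)

Section MonomialIdeals.
Variables (k : fieldType) (n : nat) (d : nat -> nat).
Implicit Types (f g h : {mpoly k[n]}) (m : 'X_{1..n}) (S : {set 'I_n}).

Definition box S m := [forall i in S, m i < d i]%N.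

(** The ideal of the ['X_i ^+ d i] with [i] in [S]. It is encoded by the monomials outside it, which
    [box] selects, so that stability under homogeneous components is immediate; [pow_idealP]
    recovers the generators. *)
Definition pow_ideal S f := forall m, box S m -> f@_m = 0.

Lemma box_le S m m' : (m' <= m)%MM -> box S m -> box S m'.
Proof.
move=> /mnm_lepP H /forall_inP B; apply/forall_inP => i iS.
exact: leq_ltn_trans (H i) (B i iS).
Qed.

Lemma pow_ideal0 S : pow_ideal S 0.
Proof. by move=> m _; rewrite mcoeff0. Qed.

Lemma pow_idealD S f g : pow_ideal S f -> pow_ideal S g -> pow_ideal S (f + g).
Proof. by move=> Hf Hg m B; rewrite mcoeffD Hf // Hg // addr0. Qed.

Lemma pow_idealN S f : pow_ideal S f -> pow_ideal S (- f).
Proof. by move=> Hf m B; rewrite mcoeffN Hf // oppr0. Qed.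

Lemma pow_idealB S f g : pow_ideal S f -> pow_ideal S g -> pow_ideal S (f - g).
Proof. by move=> Hf Hg; apply: pow_idealD => //; apply: pow_idealN. Qed.

Lemma pow_idealMl S f g : pow_ideal S f -> pow_ideal S (g * f).
Proof.
move=> Hf m B; rewrite mcoeffM big1 // => -[k1 k2] /= /eqP E.
have := lem_addl (bmnm k1) (bmnm k2); rewrite -E => le2.
by rewrite Hf ?mulr0 //; apply: box_le B.
Qed.

Lemma pow_idealZ S c f : pow_ideal S f -> pow_ideal S (c *: f).
Proof. by move=> Hf m B; rewrite mcoeffZ Hf ?mulr0. Qed.

Lemma pow_ideal_sum S (I : Type) (r : seq I) (P : pred I) (F : I -> {mpoly k[n]}) :
  (forall i, P i -> pow_ideal S (F i)) -> pow_ideal S (\sum_(i <- r | P i) F i).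
Proof.
by move=> H; apply: big_ind => //; [apply: pow_ideal0 | apply: pow_idealD].
Qed.

Lemma pow_ideal_pihomog (mf : measure n) S i f :
  pow_ideal S f -> pow_ideal S (pihomog mf i f).
Proof. by move=> Hf m B; rewrite mcoeff_pihomog Hf // if_same. Qed.

(** The terms of [f] divisible by ['X_i ^+ e] make up [u * 'X_i ^+ e], and the other terms vanish on
    [P] by hypothesis. Varying [P] allows generators to be peeled off one at a time. *)
Lemma Xexp_split (P : pred 'X_{1..n}) (i : 'I_n) e f :
  (forall m, P m -> (m i < e)%N -> f@_m = 0) ->
  exists u, forall m, P m -> (f - u * 'X_i ^+ e)@_m = 0.
Proof.
move=> H.
exists (\sum_(m <- msupp f | (e <= m i)%N) f@_m *: 'X_[m - U_(i) *+ e]).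
have -> : (\sum_(m <- msupp f | (e <= m i)%N) f@_m *: 'X_[m - U_(i) *+ e])
   * 'X_i ^+ e = \sum_(m <- msupp f | (e <= m i)%N) f@_m *: 'X_[m].
  rewrite mulr_suml; apply: eq_bigr => m le_e.
  rewrite -scalerAl mpolyXn -mpolyXD submK //.
  apply/mnm_lepP => j; rewrite mulmnE mnm1E.
  by case: eqP => [<-|_]; rewrite ?mul1n ?mul0n.
move=> m Pm; rewrite mcoeffB mcoeff_filter.
by case: leqP => Hm; rewrite ?subrr // H // subrr.
Qed.

Lemma mcoeffMXexp_lt f (i : 'I_n) e m : (m i < e)%N -> (f * 'X_i ^+ e)@_m = 0.
Proof.
rewrite mpolyXn mcoeffMX_le; case: ifP => // /mnm_lepP /(_ i).
by rewrite mulmnE mnm1E eqxx mul1n leqNgt => /negPf ->.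
Qed.

Lemma pow_ideal_exp S (i : 'I_n) e f :
  i \in S -> (d i <= e)%N -> pow_ideal S (f * 'X_i ^+ e).
Proof.
move=> iS le_e m B; apply: mcoeffMXexp_lt.
by move/forall_inP/(_ i iS): B => /leq_trans; apply.
Qed.

Lemma pow_idealP S f :
  pow_ideal S f <-> exists h : 'I_n -> {mpoly k[n]},
    f = \sum_(i in S) h i * 'X_i ^+ d i.
Proof.
split=> [|[h ->]]; last by apply: pow_ideal_sum => i iS; apply: pow_ideal_exp.
elim: {S}#|S| {-2}S (erefl #|S|) f => [|c IH] S cS f Hf.
  exists (fun=> 0); move/eqP: cS; rewrite cards_eq0 => /eqP S0.
  rewrite S0 big_set0; apply/mpolyP => m; rewrite mcoeff0; apply: Hf.
  by rewrite S0; apply/forall_inP => i; rewrite inE.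
have /card_gt0P [i iS] : (0 < #|S|)%N by rewrite cS.
have [|u Hu] := @Xexp_split (box (S :\ i)) i (d i) f.
  move=> m /forall_inP B lt_m; apply: Hf; apply/forall_inP => j jS.
  by have [-> //|ji] := eqVneq j i; apply: B; rewrite !inE ji.
have [|h Eh] := IH (S :\ i) _ _ Hu.
  by apply/eqP; rewrite -eqSS -cS (cardsD1 i S) iS.
exists (fun j => if j == i then u else h j).
rewrite (bigD1 i) //= eqxx -[LHS](subrK (u * 'X_i ^+ d i)) addrC Eh.
congr (_ + _); apply: eq_big => [j|j]; first by rewrite !inE andbC.
by rewrite !inE => /andP [/negPf ->].
Qed.

End MonomialIdeals.

(** * Linear forms modulo such an ideal, and elimination of a variable *)

Section LinearForms.
Variables (k : fieldType) (n : nat).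
Implicit Types (f g h w : {mpoly k[n]}) (m : 'X_{1..n}) (S : {set 'I_n}).

Definition lform (c : 'I_n -> k) : {mpoly k[n]} := \sum_i c i *: 'X_i.

Lemma lform_homog c : lform c \is 1.-homog.
Proof. by apply: rpred_sum => i _; rewrite rpredZ // dhomogX /= mdeg1. Qed.

Lemma box_addX d S (y : 'I_n) e m : y \notin S ->
  box d S (U_(y) *+ e + m)%MM = box d S m.
Proof.
move=> yS; apply: eq_forallb_in => i iS; rewrite mnmDE mulmnE mnm1E.
by case: eqP => [yi|_]; rewrite ?mul0n //; rewrite yi iS in yS.
Qed.

(** Compare coefficients at [m + U_(y)]: besides [c y * f@_m], only coefficients of [f] at monomials
    with a larger exponent of [y] occur. These vanish by descending induction on that exponent,
    starting beyond the degree of [f]. *)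
Lemma lform_reg d S (y : 'I_n) c f : y \notin S -> c y != 0 ->
  pow_ideal d S (lform c * f) -> pow_ideal d S f.
Proof.
move=> yS cy Hf m B.
suff: forall e m, box d S m -> (msize f <= m y + e)%N -> f@_m = 0.
  by move=> /(_ (msize f) m B) -> //; rewrite leq_addl.
elim=> [|e IH] {B}m B le_f.
  apply: memN_msupp_eq0; apply: mmeasure_mnm_ge; apply: leq_trans le_f _.
  by rewrite addn0 /= mdegE (bigD1 y) //= leq_addr.
have By : box d S (m + U_(y))%MM.
  by rewrite addmC -[U_(y)%MM]mulm1n box_addX.
have := Hf _ By; rewrite mcoeff_lin (bigD1 y) //= mnmDE mnm1E eqxx addn1 /=.
rewrite big1 ?addr0 => [|i iy].
  by rewrite addmK => /eqP; rewrite mulf_eq0 (negPf cy) => /eqP.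
case: ifP => // mi; rewrite IH ?mulr0 //.
  by apply: box_le By; apply: lem_subr.
rewrite mnmBE mnmDE !mnm1E eqxx (negPf iy) subn0.
by apply: leq_trans le_f _; lia.
Qed.

Lemma Xexp_reg d S (y : 'I_n) e w : y \notin S ->
  pow_ideal d S (w * 'X_y ^+ e) -> pow_ideal d S w.
Proof.
move=> yS Hw m B; rewrite -(mcoeffMX w (U_(y) *+ e)) -mpolyXn.
by apply: Hw; rewrite box_addX.
Qed.

Section Substitution.
Variable x : 'I_n.
Let l := lform (fun=> 1).

(* The endomorphism that fixes the other variables and kills [l]. *)
Definition subst_lform f := f \mPo [tuple if i == x then 'X_i - l else 'X_i | i < n].

Lemma subst_lformX i :
  subst_lform 'X_i = if i == x then 'X_i - l else 'X_i.
Proof. by rewrite /subst_lform comp_mpolyXU -tnth_nth tnth_mktuple. Qed.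

Lemma subst_lformM f g : subst_lform (f * g) = subst_lform f * subst_lform g.
Proof. exact: rmorphM. Qed.

Lemma subst_lformB f g : subst_lform (f - g) = subst_lform f - subst_lform g.
Proof. exact: rmorphB. Qed.

Lemma subst_lform_lform : subst_lform l = 0.
Proof.
have El : l = \sum_i 'X_i by apply: eq_bigr => i _; rewrite scale1r.
rewrite El /subst_lform raddf_sum /=.
under eq_bigr => i _ do rewrite -/(subst_lform _) subst_lformX.
rewrite (bigD1 x) //= eqxx (eq_bigr (fun i => 'X_i)) => [|i /negPf -> //].
have -> : 'X_x - l = - \sum_(i < n | i != x) 'X_i.
  by rewrite El (bigD1 x) //= opprD addNKr.
exact: addNr.
Qed.

Lemma subst_lform_ideal d S f :
  x \notin S -> pow_ideal d S f -> pow_ideal d S (subst_lform f).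
Proof.
move=> xS /pow_idealP [h ->]; rewrite /subst_lform raddf_sum /=.
apply: pow_ideal_sum => i iS.
rewrite rmorphM /= rmorphXn /= -/(subst_lform 'X_i) subst_lformX.
case: eqP => [ix|_]; first by rewrite -ix iS in xS.
exact: pow_ideal_exp.
Qed.

(** The congruence modulo [l] is clear on variables and passes to products and linear
    combinations. *)
Lemma subst_lform_mod f : exists g, f - subst_lform f = l * g.
Proof.
have HM f1 f2 : (exists g, f1 - subst_lform f1 = l * g) ->
    (exists g, f2 - subst_lform f2 = l * g) ->
    exists g, f1 * f2 - subst_lform (f1 * f2) = l * g.
  move=> [g1 E1] [g2 E2]; exists (g1 * f2 + subst_lform f1 * g2).
  rewrite subst_lformM mulrDr mulrA -E1 mulrCA -E2; ring.
have H1 : exists g, 1 - subst_lform 1 = l * g.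
  by exists 0; rewrite /subst_lform rmorph1 subrr mulr0.
elim/mpolyind: f => [|c m f _ _ [g E]].
  by exists 0; rewrite /subst_lform raddf0 subrr mulr0.
have [g' E'] : exists g, 'X_[m] - subst_lform 'X_[m] = l * g.
  rewrite mpolyXE_id; apply: (big_ind _ H1 HM) => i _.
  elim: (m i) => [|e IH]; first by rewrite expr0.
  rewrite exprS; apply: HM (IH); rewrite subst_lformX; case: (i == x).
    by exists 1; ring.
  by exists 0; ring.
exists (c *: g' + g); rewrite /subst_lform comp_mpolyD linearZ /=.
rewrite -/(subst_lform f) -/(subst_lform 'X_[m]).
rewrite mulrDr -E -scalerAr -E' scalerBr; ring.
Qed.

(** The variable [x] goes to minus the sum of the other variables, and polynomials free of [x] are
    closed under products. *)
Lemma mcoeff_subst_lform f m : m x != 0%N -> (subst_lform f)@_m = 0.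
Proof.
pose free f := forall m, m x != 0%N -> f@_m = 0.
have freeM g h : free g -> free h -> free (g * h).
  move=> Hg Hh m' m'x; rewrite mcoeffM big1 // => -[k1 k2] /= /eqP E.
  have [k1x|k1x] := eqVneq (bmnm k1 x) 0%N; last by rewrite Hg ?mul0r.
  have := congr1 (fun m0 : 'X_{1..n} => m0 x) E.
by rewrite mnmDE k1x add0n => E'; rewrite Hh ?mulr0 // -E'.
have free1 : free 1.
  move=> m' m'x; rewrite mcoeff1; case: eqP => // E.
  by rewrite E mnm0E eqxx in m'x.
have freeX i : i != x -> free 'X_i.
  move=> ix m' m'x; rewrite mcoeffX; case: eqP => // E.
  by rewrite -E mnm1E (negPf ix) in m'x.
move: m; rewrite -/(free _) /subst_lform comp_mpolyE => m mx.
rewrite raddf_sum /= big1 // => m' _; rewrite mcoeffZ.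
suff -> : (\prod_(i < n) tnth [tuple if i == x then 'X_i - l else 'X_i | i < n] i
  ^+ m' i)@_m = 0 by rewrite mulr0.
apply: (big_ind free) mx => // i _.
elim: (m' i) => [|e IH]; first by rewrite expr0.
rewrite exprS; apply: freeM => //; rewrite tnth_mktuple.
case: eqP => [->|/eqP]; last exact: freeX.
rewrite /l /lform (bigD1 x) //= scale1r opprD addNKr => m'' m''x.
rewrite mcoeffN raddf_sum big1 ?oppr0 //= => j jx.
by rewrite scale1r freeX.
Qed.

End Substitution.
End LinearForms.

(** * Comparison of the exponents [(c, e)] and [(c + N, e + N)] of [x] and [y] *)

Section Periodicity.
Variables (k : fieldType) (n : nat) (d : nat -> nat) (S : {set 'I_n}).
Variables (x y : 'I_n).
Hypotheses (xS : x \notin S) (yS : y \notin S) (yx : y != x).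
Implicit Types (f g h u v w : {mpoly k[n]}) (m : 'X_{1..n}).

Let l : {mpoly k[n]} := lform (fun=> 1).
Let X : {mpoly k[n]} := 'X_x.
Let Y : {mpoly k[n]} := 'X_y.
Local Notation J := (pow_ideal d S).
Local Notation hc := (pihomog mdeg).

(** The ideal generated by [J], [X ^+ c] and [Y ^+ e]; the two exponents are separate from [d] so
    that they can change while [J] stays fixed. *)
Definition pow_ideal2 c e f :=
  forall m, box d S m -> (m x < c)%N -> (m y < e)%N -> f@_m = 0.

Lemma pow_ideal2P c e f :
  pow_ideal2 c e f <-> exists u v, J (f - u * X ^+ c - v * Y ^+ e).
Proof.
split=> [Hf|[u [v Huv]] m B mx my]; last first.
  have := Huv m B; rewrite !mcoeffB.
  by rewrite [(v * _)@__]mcoeffMXexp_lt // [(u * _)@__]mcoeffMXexp_lt // !subr0.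
have [|u Hu] := @Xexp_split _ _ [pred m | box d S m & (m y < e)%N] x c f.
  by move=> m /andP [B my] mx; apply: Hf.
have [|v Hv] := @Xexp_split _ _ (box d S) y e (f - u * X ^+ c).
  by move=> m B my; apply: Hu; apply/andP.
by exists u, v.
Qed.

Lemma pow_ideal2_pihomog c e i f : pow_ideal2 c e f -> pow_ideal2 c e (hc i f).
Proof. by move=> Hf m B mx my; rewrite mcoeff_pihomog Hf // if_same. Qed.

Lemma pihomog_lM i f : hc i.+1 (l * f) = l * hc i f.
Proof. by rewrite -add1n pihomogM ?lform_homog. Qed.

Lemma pihomogMXexp (z : 'I_n) e i f : hc (i + e) (f * 'X_z ^+ e) = hc i f * 'X_z ^+ e.
Proof.
rewrite addnC mulrC pihomogM 1?mulrC // mpolyXn dhomogX /=.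
by rewrite mdegMn mdeg1 mul1n.
Qed.

(* [Y] is regular modulo [J + (l)]: eliminating [x] turns the quotient by [l]
   into a polynomial ring in which [J] does not involve [Y]. *)
Lemma Xexp_reg_lform e w f :
  J (w * Y ^+ e - l * f) -> exists f', J (w - l * f').
Proof.
move=> /(subst_lform_ideal xS); rewrite subst_lformB !subst_lformM.
rewrite subst_lform_lform mul0r subr0 /subst_lform rmorphXn /=.
rewrite -![_ \mPo _]/(subst_lform x _) subst_lformX (negPf yx).
move=> /(Xexp_reg yS) Hw; have [g Eg] := subst_lform_mod x w.
by exists g; rewrite -/l in Eg; rewrite -Eg opprB addrC subrK.
Qed.

Definition inj2 c e i :=
  forall f, f \is i.-homog -> pow_ideal2 c e (l * f) -> pow_ideal2 c e f.

Definition surj2 c e i := forall g, g \is i.+1.-homog ->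
  exists2 f, f \is i.-homog & pow_ideal2 c e (g - l * f).

(** Witnesses built below need not be homogeneous. Here and in [surj2_pihomog] one component
    suffices, since [l] has degree 1 and the ideal is homogeneous. *)
Lemma inj2_pihomog c e i f : inj2 c e i ->
  pow_ideal2 c e (l * f) -> pow_ideal2 c e (hc i f).
Proof.
move=> Hi Hf; apply: Hi; first exact: pihomogP.
by rewrite -pihomog_lM; apply: pow_ideal2_pihomog.
Qed.

Lemma surj2_pihomog c e i g f : g \is i.+1.-homog ->
  pow_ideal2 c e (g - l * f) ->
  exists2 f', f' \is i.-homog & pow_ideal2 c e (g - l * f').
Proof.
move=> Hg Hf; exists (hc i f); first exact: pihomogP.
rewrite -pihomog_lM -{1}(pihomog_dE Hg) -pihomogB.
exact: pow_ideal2_pihomog.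
Qed.

(** In degree [i.+1] the powers [X ^+ c] and [Y ^+ e] are not yet visible, so the ideal agrees with
    [J], modulo which [l] is regular. *)
Lemma inj2_small c e i : (i.+1 < c)%N -> (i.+1 < e)%N -> inj2 c e i.
Proof.
move=> ic ie f Hf Hlf m B _ _.
apply: (@lform_reg _ _ d S y (fun=> 1)) B; rewrite ?oner_eq0 // => {}m B.
have lf : l * f \is i.+1.-homog by rewrite -add1n dhomogM ?lform_homog.
have [mi|mi] := eqVneq (mdeg m) i.+1; last exact: dhomog_nemf_coeff lf mi.
have le_mdeg z : (m z <= mdeg m)%N by rewrite mdegE (bigD1 z) //= leq_addr.
by apply: Hlf => //; apply: leq_ltn_trans (le_mdeg _) _; rewrite mi.
Qed.

(** * Multiplication by [Y ^+ N], congruent to [eps * X ^+ N] modulo [J] and [l] *)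

Section Shift.
Variables (N : nat) (eps g0 : {mpoly k[n]}).
Hypothesis eps0 : eps \is 0.-homog.
Hypothesis eps2 : eps * eps = 1.
Hypothesis YX : J (Y ^+ N - eps * X ^+ N - l * g0).

(** Multiply [l * f = u * X ^+ c + v * Y ^+ e] (modulo [J]) by [Y ^+ N] and rewrite
    [X ^+ c * Y ^+ N] by [YX]; the resulting multiple of [l] is absorbed into [F]. This correction
    is a multiple of [X ^+ c], invisible at monomials with [m x < c]. *)
Lemma inj2_unshift c e i : inj2 (c + N) (e + N) (i + N) -> inj2 c e i.
Proof.
move=> Hi f Hf /pow_ideal2P [u [v Huv]].
pose F := f * Y ^+ N - u * g0 * X ^+ c.
have HF : pow_ideal2 (c + N) (e + N) (l * F).
  apply/pow_ideal2P; exists (eps * u), v.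
  have -> : l * F - eps * u * X ^+ (c + N) - v * Y ^+ (e + N) =
    Y ^+ N * (l * f - u * X ^+ c - v * Y ^+ e)
    + (u * X ^+ c) * (Y ^+ N - eps * X ^+ N - l * g0).
    by rewrite /F !exprD; ring.
  by apply: pow_idealD; apply: pow_idealMl.
have := inj2_pihomog Hi HF; rewrite pihomogB pihomogMXexp (pihomog_dE Hf) => HF' m B mx my.
have := HF' (U_(y) *+ N + m)%MM.
rewrite mcoeffB /Y mpolyXn mcoeffMX mcoeff_pihomog mcoeffMXexp_lt.
  rewrite if_same subr0; apply; first by rewrite box_addX.
    by rewrite mnmDE mulmnE mnm1E (negPf yx) ltn_addr.
  by rewrite mnmDE mulmnE mnm1E eqxx mul1n addnC ltn_add2r.
by rewrite mnmDE mulmnE mnm1E (negPf yx).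
Qed.

(** Lift [g * Y ^+ N]. Since [eps * eps = 1], [X ^+ N] can be traded for [eps * Y ^+ N] modulo [J]
    and [l]; then every term outside [(l)] carries the factor [Y ^+ N], which is cancelled. *)
Lemma surj2_unshift c e i : surj2 (c + N) (e + N) (i + N) -> surj2 c e i.
Proof.
move=> Hs g Hg.
have [|f0 _ /pow_ideal2P [u [v Huv]]] := Hs (g * Y ^+ N).
  rewrite -addSn dhomogM // -[X in X.-homog]mul1n dhomogMn // dhomogX /=.
  by rewrite mdeg1.
have [|f' Hf'] := @Xexp_reg_lform N (g - v * Y ^+ e - eps * u * X ^+ c)
  (f0 - eps * u * X ^+ c * g0).
  have -> : (g - v * Y ^+ e - eps * u * X ^+ c) * Y ^+ N -
      l * (f0 - eps * u * X ^+ c * g0) =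
    (g * Y ^+ N - l * f0 - u * X ^+ (c + N) - v * Y ^+ (e + N))
    - (eps * u * X ^+ c) * (Y ^+ N - eps * X ^+ N - l * g0)
    + (1 - eps * eps) * (u * X ^+ (c + N)).
    by rewrite !exprD; ring.
  rewrite eps2 subrr mul0r addr0.
  by apply: pow_idealB => //; apply: pow_idealMl.
apply: (surj2_pihomog Hg (f := f')); apply/pow_ideal2P.
exists (eps * u), v; move: Hf'; congr (J _); ring.
Qed.

(** From [l * F = u * X ^+ (c + N) + v * Y ^+ (e + N)] modulo [J], cancelling [Y ^+ N] gives
    [eps * u * X ^+ c + v * Y ^+ e = l * f']. Injectivity expresses the degree [i] part of [f']
    through [u'] and [v'], from which an element [W] of the shifted ideal congruent to [F] is
    built. *)
Lemma inj2_shift c e i :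
  (i.+1 < c + e)%N -> inj2 c e i -> inj2 (c + N) (e + N) (i + N).
Proof.
move=> lt_i Hi F HF /pow_ideal2P [u [v Huv]].
set j := _ - _ in Huv.
have [|f' Hf'] := @Xexp_reg_lform N (eps * u * X ^+ c + v * Y ^+ e)
  (F + eps * u * X ^+ c * g0).
  have -> : (eps * u * X ^+ c + v * Y ^+ e) * Y ^+ N -
      l * (F + eps * u * X ^+ c * g0) =
    eps * u * X ^+ c * (Y ^+ N - eps * X ^+ N - l * g0) - j
    - (1 - eps * eps) * (u * X ^+ (c + N)).
    by rewrite /j !exprD; ring.
  rewrite eps2 subrr mul0r subr0.
  by apply: pow_idealB => //; apply: pow_idealMl.
have : pow_ideal2 c e (hc i f').
  apply: inj2_pihomog => //; apply/pow_ideal2P; exists (eps * u), v.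
  by rewrite -opprB; move: (pow_idealN Hf'); congr (J _); ring.
move=> /pow_ideal2P [u' [v' Huv']].
pose U := eps * u - l * u'; pose V := v - l * v'.
pose A := eps * u * X ^+ c + v * Y ^+ e - l * f'.
pose C := hc i f' - u' * X ^+ c - v' * Y ^+ e.
have HUV : J (hc i.+1 (U * X ^+ c + V * Y ^+ e)).
  have -> : U * X ^+ c + V * Y ^+ e = A + l * (f' - hc i f') + l * C.
    by rewrite /U /V /A /C; ring.
  rewrite (pihomogD _ _ (A + _)) (pihomogD _ _ A) !pihomog_lM pihomogB pihomog_id subrr mulr0 addr0.
  by apply: pow_idealD; [|apply: pow_idealMl]; apply: pow_ideal_pihomog.
(* As [i.+1 < c + e], no monomial of degree [i.+1] is divisible by both [X ^+ c] and [Y ^+ e]. The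
   two summands cannot cancel, so each lies in [J]. *)
have HU : J (hc i.+1 (U * X ^+ c)).
  move=> m B; rewrite mcoeff_pihomog; case: eqP => // mi.
  have [mx|mx] := ltnP (m x) c; first exact: mcoeffMXexp_lt.
  have [my|my] := ltnP (m y) e; last first.
    move: lt_i; rewrite -mi /= mdegE (bigD1 x) //= (bigD1 y) //=.
    by rewrite addnA ltnNge (leq_trans (leq_add mx my)) // leq_addr.
  have := HUV m B; rewrite mcoeff_pihomog mi eqxx mcoeffD.
  by rewrite [(V * _)@__]mcoeffMXexp_lt // addr0.
have HV : J (hc i.+1 (V * Y ^+ e)).
  have -> : V * Y ^+ e = U * X ^+ c + V * Y ^+ e - U * X ^+ c by ring.
  by rewrite pihomogB; apply: pow_idealB.
pose W := hc (i + N) (eps * u' * X ^+ (c + N) + v' * Y ^+ (e + N)).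
have HW : pow_ideal2 (c + N) (e + N) W.
  apply/pow_ideal2_pihomog/pow_ideal2P; exists (eps * u'), v'.
  by rewrite [X in J X](_ : _ = 0); [apply: pow_ideal0 | ring].
suff HFW : J (F - W).
  move=> m B mx my; rewrite -(subrK W F) mcoeffD HW // addr0.
  exact: HFW.
apply: (@lform_reg _ _ d S y (fun=> 1)); rewrite ?oner_eq0 // -/l.
have -> : l * (F - W) = hc (i + N).+1 (j + eps * (U * X ^+ c) * X ^+ N
    + (V * Y ^+ e) * Y ^+ N + (1 - eps * eps) * (u * X ^+ (c + N))).
  rewrite -(pihomog_dE HF) -pihomogB -pihomog_lM; congr (hc _ _).
  by rewrite /U /V /j !exprD; ring.
rewrite eps2 subrr mul0r addr0 -addSn.
rewrite (pihomogD _ _ (j + _)) (pihomogD _ _ j) !pihomogMXexp.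
rewrite -[X in hc X (eps * _)]add0n pihomogM //.
apply: pow_idealD; last by rewrite mulrC; apply: pow_idealMl.
apply: pow_idealD; first exact: pow_ideal_pihomog.
by rewrite mulrC !mulrA; apply: pow_idealMl.
Qed.

(** Eliminating [x] from a form of degree [i.+1 + N] leaves, modulo [J], monomials of degree at most
    [t + m y]; as [t <= i.+1], all are divisible by [Y ^+ N]. The cofactor is lifted in degree [i]
    and multiplied back by [Y ^+ N]. *)
Lemma surj2_shift c e i t :
  (forall m, box d S m -> m x = 0%N -> (mdeg m <= t + m y)%N) ->
  (t <= i.+1)%N -> surj2 c e i -> surj2 (c + N) (e + N) (i + N).
Proof.
move=> le_t ti Hs G HG.
have [h1 E1] := subst_lform_mod x G; rewrite -/l in E1.
pose G1 := hc (i.+1 + N) (subst_lform x G).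
have [|G2 HG2] := @Xexp_split _ _ (box d S) y N G1.
  move=> m B my; rewrite mcoeff_pihomog; case: eqP => //= mi.
  have [mx|mx] := eqVneq (m x) 0%N; last exact: mcoeff_subst_lform.
  by have := leq_add ti my; rewrite addnS -mi ltnNge le_t.
have [f _ /pow_ideal2P [u [v Huv]]] := Hs _ (pihomogP _ i.+1 G2).
apply: (surj2_pihomog HG (f := hc (i + N) h1 + f * Y ^+ N + u * X ^+ c * g0)).
apply/pow_ideal2P; exists (eps * u), v.
have {}E1 : G = G1 + l * hc (i + N) h1.
  by rewrite -pihomog_lM -E1 -addSn pihomogB (pihomog_dE HG) addrC subrK.
have HG3 : J (G1 - hc i.+1 G2 * Y ^+ N).
  rewrite -pihomogMXexp -[X in X - _]pihomog_id -pihomogB.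
  exact: pow_ideal_pihomog HG2.
have -> : G - l * (hc (i + N) h1 + f * Y ^+ N + u * X ^+ c * g0)
    - eps * u * X ^+ (c + N) - v * Y ^+ (e + N) =
  (G1 - hc i.+1 G2 * Y ^+ N)
  + Y ^+ N * (hc i.+1 G2 - l * f - u * X ^+ c - v * Y ^+ e)
  + u * X ^+ c * (Y ^+ N - eps * X ^+ N - l * g0).
  by rewrite [in LHS]E1 !exprD; ring.
by do 2?apply: pow_idealD => //; apply: pow_idealMl.
Qed.

End Shift.
End Periodicity.

(** With [q = p ^ a], [l ^+ q] is the sum of the ['X_i ^+ q], and all of these but two lie in the
    ideal because [d i <= q]. Hence ['X_y ^+ q] is congruent to [- 'X_x ^+ q]; then take [b]-th
    powers. *)
Lemma frobenius_lform (k : fieldType) (n : nat) (d : nat -> nat) (S : {set 'I_n})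
    (x y : 'I_n) (p a b : nat) :
  p \in [pchar k] -> y != x -> x \notin S -> y \notin S ->
  (forall i, i != x -> i != y -> i \in S) ->
  (forall i, i \in S -> (d i <= p ^ a)%N) ->
  exists g : {mpoly k[n]}, pow_ideal d S
    ('X_y ^+ (b * p ^ a) - (-1) ^+ b * 'X_x ^+ (b * p ^ a) - lform (fun=> 1) * g).
Proof.
move=> pk yx xS yS xyS le_d; set q := (p ^ a)%N; set l := lform _.
have p_gt0 : (0 < p)%N by case/andP: pk => /prime_gt0.
have q_gt0 : (0 < q)%N by rewrite expn_gt0 p_gt0.
have lq : l ^+ q = \sum_i 'X_i ^+ q :> {mpoly k[n]}.
  rewrite /l /lform (eq_bigr (fun i => 'X_i)) => [|i _]; last by rewrite scale1r.
  apply: (big_morph (fun f : {mpoly k[n]} => f ^+ q)) => [f g|].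
    apply: exprDn_pchar; rewrite -(pchar_lalg {mpoly k[n]}) in pk.
    by rewrite (eq_pnat _ (pcharf_eq pk)) pnatX pnat_id //; case/andP: pk.
  by rewrite expr0n -leqn0 leqNgt q_gt0.
pose w : {mpoly k[n]} := \sum_(i < n | (i != x) && (i != y)) 'X_i ^+ q.
have Hw : pow_ideal d S w.
  apply: pow_ideal_sum => i /andP [ix iy].
  by rewrite -['X_i ^+ q]mul1r; apply: pow_ideal_exp; rewrite ?le_d ?xyS.
have E : 'X_y ^+ q - - 'X_x ^+ q = l * l ^+ q.-1 - w.
  rewrite -exprS prednK // lq (bigD1 x) //= (bigD1 y) //= -/w; ring.
(* The sum is the cofactor of [A - B] in [A ^+ b - B ^+ b], for [A = 'X_y ^+ q] and
   [B = - 'X_x ^+ q]. *)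
exists (l ^+ q.-1 * (\sum_(i < b) ('X_y ^+ q) ^+ (b.-1 - i) * (- 'X_x ^+ q) ^+ i)).
have -> : 'X_y ^+ (b * q) - (-1) ^+ b * 'X_x ^+ (b * q) =
   ('X_y ^+ q) ^+ b - (- 'X_x ^+ q) ^+ b :> {mpoly k[n]}.
  by rewrite [in RHS]exprNn -!exprM mulnC.
rewrite subrXX E mulrA mulrBl addrAC subrr add0r -mulNr mulrC.
by apply: pow_idealMl; apply: pow_idealN.
Qed.

(** * The torus action rescaling the variables *)

Section ScaleVariables.
Variables (k : fieldType) (n : nat) (d : nat -> nat).
Implicit Types (f g h : {mpoly k[n]}) (m : 'X_{1..n}) (c : 'I_n -> k).

Definition scale_vars c f := f \mPo [tuple c i *: 'X_i | i < n].

Lemma mcoeff_scale_vars c f m :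
  (scale_vars c f)@_m = f@_m * \prod_i c i ^+ m i.
Proof.
elim/mpolyind: f => [|b m' f _ _ IH].
  by rewrite /scale_vars comp_mpoly0 mcoeff0 mul0r.
rewrite /scale_vars comp_mpolyD comp_mpolyZ !mcoeffD IH mulrDl !mcoeffZ.
congr (_ + _); rewrite -mulrA; congr (_ * _).
rewrite comp_mpolyX (eq_bigr (fun i => c i ^+ m' i *: 'X_i ^+ m' i)); last first.
  by move=> i _; rewrite tnth_mktuple exprZn.
rewrite scaler_prod -mpolyXE_id mcoeffZ mcoeffX.
by case: eqP => [->|_]; rewrite ?mulr1 ?mul1r // mul0r mulr0.
Qed.

Lemma scale_vars_lform c f :
  scale_vars c (lform (fun=> 1) * f) = lform c * scale_vars c f.
Proof.
rewrite /scale_vars rmorphM /=; congr (_ * _).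
rewrite /lform raddf_sum; apply: eq_bigr => i _ /=.
by rewrite scale1r comp_mpolyXU -tnth_nth tnth_mktuple.
Qed.

Lemma scale_varsB c f g : scale_vars c (f - g) = scale_vars c f - scale_vars c g.
Proof. exact: rmorphB. Qed.

Lemma scale_vars_ideal S c f : (forall i, c i != 0) ->
  pow_ideal d S (scale_vars c f) <-> pow_ideal d S f.
Proof.
move=> c0; split=> Hf m B; last by rewrite mcoeff_scale_vars Hf ?mul0r.
have := Hf m B; rewrite mcoeff_scale_vars => /eqP; rewrite mulf_eq0.
case/orP => /eqP // E; have /eqP := E.
by rewrite prodf_seq_eq0 => /hasP [i _ /=]; rewrite expf_eq0 (negPf (c0 i)) andbF.
Qed.

Lemma scale_vars_homog c i f : f \is i.-homog -> scale_vars c f \is i.-homog.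
Proof.
move=> Hf; apply/dhomogP => m; rewrite mcoeff_msupp mcoeff_scale_vars => Hm.
apply/eqP; apply: contraNT Hm => /(dhomog_nemf_coeff Hf) ->.
by rewrite mul0r.
Qed.

Lemma scale_varsK c f : (forall i, c i != 0) ->
  scale_vars c (scale_vars (fun i => (c i)^-1) f) = f.
Proof.
move=> c0; apply/mpolyP => m; rewrite !mcoeff_scale_vars -mulrA -big_split /=.
by rewrite big1 ?mulr1 // => i _; rewrite exprVn mulVf // expf_neq0.
Qed.

End ScaleVariables.

Lemma mci_idealP (k : fieldType) (n : nat) (d : nat -> nat) (f : {mpoly k[n]}) :
  mci_ideal d f <-> pow_ideal d setT f.
Proof.
split=> [[h ->]|/pow_idealP [h ->]].
  by apply: pow_ideal_sum => i _; apply: pow_ideal_exp; rewrite ?inE.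
by exists h; apply: eq_bigl => i; rewrite inE.
Qed.

(** The weight used for the degeneration, with [T] the set of variables missing from a linear form.
    As a measure it gives weight components through [pihomog]. *)
Definition part_deg (n : nat) (T : {set 'I_n}) (m : 'X_{1..n}) : nat :=
  (\sum_(i in T) m i)%N.

Lemma part_deg0 n (T : {set 'I_n}) : part_deg T 0%MM = 0%N.
Proof. by rewrite /part_deg big1 // => i _; rewrite mnm0E. Qed.

Lemma part_degD n (T : {set 'I_n}) : {morph part_deg T : m1 m2 / (m1 + m2)%MM >-> (m1 + m2)%N}.
Proof.
by move=> m1 m2; rewrite /part_deg -big_split; apply: eq_bigr => i _; rewrite mnmDE.
Qed.

HB.instance Definition _ n (T : {set 'I_n}) :=
  isMeasure.Build n (part_deg T) (part_deg0 T) (@part_degD n T).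

Lemma part_degU n (T : {set 'I_n}) i : part_deg T U_(i) = (i \in T).
Proof.
rewrite /part_deg; have [iT|iT] := boolP (i \in T).
  rewrite (bigD1 i) //= mnm1E eqxx big1 // => j /andP [_ /negPf].
  by rewrite mnm1E eq_sym => ->.
by rewrite big1 // => j jT; rewrite mnm1E; case: eqP => // ij; rewrite ij jT in iT.
Qed.

(** * Reduction to the sum of the variables *)

Section NormalForm.
Variables (k : fieldType) (n : nat) (d : nat -> nat).
Implicit Types (f g h : {mpoly k[n]}) (m : 'X_{1..n}) (c : 'I_n -> k).

Local Notation I := (@pow_ideal k n d setT).

Lemma pihomog_mdeg_homog (mf : measure n) i j f :
  f \is i.-homog -> pihomog mf j f \is i.-homog.
Proof.
move=> Hf; apply/dhomogP => m; rewrite mcoeff_msupp mcoeff_pihomog => Hm.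
apply/eqP; apply: contraNT Hm => /(dhomog_nemf_coeff Hf) ->.
by rewrite if_same.
Qed.

Section FillZeros.
Variable c : 'I_n -> k.
Let T : {set 'I_n} := [set i | c i == 0].
Let lT : {mpoly k[n]} := lform (fun i => (i \in T)%:R).
Let c' i := if c i == 0 then 1 else c i.
Local Notation hT := (pihomog (part_deg T)).

Lemma lform_fill : lform c' = lform c + lT.
Proof.
rewrite /lT /lform -big_split; apply: eq_bigr => i _ /=.
rewrite -scalerDl inE /c'; case: eqP => [->|_]; first by rewrite add0r.
by rewrite addr0.
Qed.

Lemma lform_part_homog : lform c \is 0.-homog for (part_deg T).
Proof.
apply: rpred_sum => i _; have [->|ci] := eqVneq (c i) 0.
  by rewrite scale0r rpred0.
by rewrite rpredZ // dhomogX /= part_degU inE (negPf ci).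
Qed.

Lemma lT_part_homog : lT \is 1.-homog for (part_deg T).
Proof.
apply: rpred_sum => i _; have [iT|_] := boolP (i \in T).
  by rewrite rpredZ // dhomogX /= part_degU iT.
by rewrite scale0r rpred0.
Qed.

Lemma pihomog_lc w f : hT w (lform c * f) = lform c * hT w f.
Proof. by rewrite -[X in hT X (lform c * _)]add0n pihomogM // lform_part_homog. Qed.

Lemma pihomog_lT w f : hT w.+1 (lT * f) = lT * hT w f.
Proof. by rewrite -add1n pihomogM // lT_part_homog. Qed.

Lemma pihomog_lT0 f : hT 0 (lT * f) = 0.
Proof.
apply/mpolyP => m; rewrite mcoeff_pihomog mcoeff0; case: eqP => // m0.
rewrite mcoeff_lin big1 // => i _; case: eqP => // /eqP mi.
have [iT|_] := boolP (i \in T); last by rewrite mul0r.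
move/eqP: m0; rewrite /= sum_nat_eq0 => /forall_inP /(_ i iT).
by rewrite (negPf mi).
Qed.

(** The form [lform c] has weight 0 and [lT] weight 1, so the component of weight [w.+1] of the
    product is [lform c * hT w.+1 f + lT * hT w f]. Induction on the weight puts each component of
    [f] in the ideal. *)
Lemma mult_injective_fill i :
  mult_injective d (lform c) i -> mult_injective d (lform c') i.
Proof.
rewrite lform_fill => Hi f Hf /mci_idealP Hlf; apply/mci_idealP.
suff Hw w : I (hT w f).
  by move=> m B; have := Hw (part_deg T m) m B; rewrite mcoeff_pihomog eqxx.
have hTf v : hT v f \is i.-homog by apply: pihomog_mdeg_homog.
elim: w => [|w IH]; apply/mci_idealP/Hi => //; apply/mci_idealP.
  have := pow_ideal_pihomog (part_deg T) 0 Hlf.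
  by rewrite mulrDl pihomogD pihomog_lc pihomog_lT0 addr0.
have := pow_ideal_pihomog (part_deg T) w.+1 Hlf.
rewrite mulrDl pihomogD pihomog_lc pihomog_lT => H.
by rewrite -(addrK (lT * hT w f) (lform c * _)); apply: pow_idealB => //; apply: pow_idealMl.
Qed.

(** The preimage is corrected weight by weight: subtracting a lift of the error of weight [w]
    creates new error only in weight [w.+1]. In degree [i.+1] the weights stop at [i.+1]. *)
Lemma mult_surjective_fill i :
  mult_surjective d (lform c) i -> mult_surjective d (lform c') i.
Proof.
rewrite lform_fill => Hs g Hg; set l' := _ + _.
have l'_homog : l' \is 1.-homog by rewrite rpredD ?lform_homog.
have [f Hf Hv] : exists2 f, f \is i.-homog &
    forall v, (v < i.+2)%N -> I (hT v (g - l' * f)).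
  elim: i.+2 => [|w [f Hf Hv]]; first by exists 0; rewrite ?rpred0.
  have rw : hT w (g - l' * f) \is i.+1.-homog.
    by apply: pihomog_mdeg_homog; rewrite rpredB // -add1n dhomogM.
  have [f1 Hf1 /mci_idealP Hr] := Hs _ rw.
  exists (f + hT w f1); first by rewrite rpredD // pihomog_mdeg_homog.
  move=> v; have -> : g - l' * (f + hT w f1) =
    (g - l' * f) - lform c * hT w f1 - lT * hT w f1 by rewrite /l'; ring.
  have lTf : lT * hT w f1 \is w.+1.-homog for (part_deg T).
    by rewrite -add1n dhomogM ?lT_part_homog ?pihomogP.
  rewrite ltnS leq_eqVlt !pihomogB pihomog_lc => /orP [/eqP ->|lt_vw].
    rewrite (pihomog_ne0 _ lTf) ?subr0; last by rewrite gtn_eqF.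
    have := pow_ideal_pihomog (part_deg T) w Hr.
    by rewrite !pihomogB pihomog_lc !pihomog_id.
  rewrite (pihomog_ne0 _ lTf) ?subr0; last by rewrite gtn_eqF // ltnW.
  rewrite (@pihomog_ne0 _ _ _ w v (hT w f1)) ?pihomogP //; last by rewrite gtn_eqF.
  by rewrite mulr0 subr0 -pihomogB; apply: Hv.
exists f => //; apply/mci_idealP => m B.
have [mi|mi] := eqVneq (mdeg m) i.+1; last first.
  by apply: dhomog_nemf_coeff mi; rewrite rpredB // -add1n dhomogM.
have lt_m : (part_deg T m < i.+2)%N.
  by rewrite ltnS -mi mdegE /part_deg [leqLHS]big_mkcond leq_sum // => j _; case: ifP.
by have := Hv _ lt_m m B; rewrite mcoeff_pihomog eqxx.
Qed.

End FillZeros.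

Lemma mult_injective_scale c i : (forall j, c j != 0) ->
  mult_injective d (lform c) i -> mult_injective d (@lform k n (fun=> 1)) i.
Proof.
move=> c0 Hi f Hf /mci_idealP /(scale_vars_ideal d setT _ c0) Hlf.
apply/mci_idealP/(scale_vars_ideal d setT _ c0)/mci_idealP/Hi.
  exact: scale_vars_homog.
by apply/mci_idealP; rewrite -scale_vars_lform.
Qed.

Lemma mult_surjective_scale c i : (forall j, c j != 0) ->
  mult_surjective d (lform c) i -> mult_surjective d (@lform k n (fun=> 1)) i.
Proof.
move=> c0 Hs g Hg; have [f Hf Hgf] := Hs _ (scale_vars_homog c Hg).
exists (scale_vars (fun j => (c j)^-1) f); first exact: scale_vars_homog.
apply/mci_idealP/(scale_vars_ideal d setT _ c0).
by rewrite scale_varsB scale_vars_lform scale_varsK //; apply/mci_idealP.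
Qed.

(** Zero coefficients of the given form are first replaced by 1, then all coefficients are rescaled
    to 1; both steps keep injectivity and surjectivity in each degree. *)
Lemma has_WLP_lform : has_WLP k n d <->
  forall i, mult_injective d (@lform k n (fun=> 1)) i
         \/ mult_surjective d (@lform k n (fun=> 1)) i.
Proof.
split=> [[l Hl Hi] i|H]; last by exists (lform (fun=> 1)); rewrite ?lform_homog.
have El : l = lform (fun j => l@_U_(j)).
  apply/mpolyP => m; rewrite raddf_sum /=.
  under eq_bigr => j _ do rewrite mcoeffZ.
  have [/mdeg1P [j /eqP ->]|m1] := boolP (mdeg m == 1%N).
    rewrite (bigD1 j) //= mcoeffXU eqxx mulr1 big1 ?addr0 // => j' jj'.
    by rewrite mcoeffXU (negPf jj') mulr0.
  rewrite (dhomog_nemf_coeff Hl m1) big1 // => j _.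
  rewrite mcoeffX; case: eqP => [E|_].
    by rewrite -E mdeg1 in m1.
  by rewrite mulr0.
pose c' j := if l@_U_(j) == 0 then 1 else l@_U_(j).
have c'0 j : c' j != 0 by rewrite /c'; case: ifPn => // _; rewrite oner_eq0.
have [] := Hi i; rewrite El.
  by move=> /mult_injective_fill /(mult_injective_scale c'0); left.
by move=> /mult_surjective_fill /(mult_surjective_scale c'0); right.
Qed.

End NormalForm.

(** A vector orthogonal to the left kernel of a matrix lies in its column space. The index type is
    arbitrary so that monomials of bounded degree can serve as indices. *)
Lemma fredholm (k : fieldType) (T : finType) (K : T -> T -> k) (v : T -> k) :
  (forall w : T -> k, (forall s, \sum_t w t * K t s = 0) -> \sum_t w t * v t = 0) ->
  exists z : T -> k, forall t, \sum_s K t s * z s = v t.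
Proof.
have big_rank (F : T -> k) : \sum_t F t = \sum_(i < #|T|) F (enum_val i).
  exact: big_enum_val.
move=> H; pose M := \matrix_(i < #|T|, j < #|T|) K (enum_val i) (enum_val j).
pose V := \row_(i < #|T|) v (enum_val i).
have /submxP [D ED] : (V <= M^T)%MS.
  rewrite submxE; apply/eqP/matrixP => i0 j; rewrite !mxE.
  pose C := cokermx M^T.
  have := H (fun t => C (enum_rank t) j); rewrite big_rank => Hw.
  rewrite -[RHS]Hw => [|s].
    by apply: eq_bigr => i _; rewrite !mxE enum_valK mulrC.
  have := congr1 (fun A : 'M_#|T| => A (enum_rank s) j) (mulmx_coker M^T).
  rewrite !mxE => {2}<-; rewrite big_rank; apply: eq_bigr => i _.
  by rewrite !mxE enum_valK enum_rankK mulrC.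
exists (fun s => D 0 (enum_rank s)) => t.
have := congr1 (fun A : 'rV_#|T| => A 0 (enum_rank t)) ED.
rewrite !mxE enum_rankK => ->; rewrite big_rank; apply: eq_bigr => i _.
by rewrite !mxE enum_valK enum_rankK mulrC.
Qed.

(** * Poincare duality for monomial complete intersections *)

Section Duality.
Variables (k : fieldType) (n : nat) (d : nat -> nat).
Hypothesis d_gt0 : forall i, (i < n)%N -> (0 < d i)%N.
Variable l : {mpoly k[n]}.
Hypothesis l_homog : l \is 1.-homog.
Implicit Types (f g h : {mpoly k[n]}) (m : 'X_{1..n}).

Local Notation I := (@pow_ideal k n d setT).

Definition socle_mnm : 'X_{1..n} := [multinom (d i).-1 | i < n].

Lemma box_socle m : box d setT m = (m <= socle_mnm)%MM.
Proof.
apply/forall_inP/mnm_lepP => H i; have di := d_gt0 (ltn_ord i).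
  by rewrite mnmE -ltnS prednK // H ?inE.
by move=> _; have := H i; rewrite mnmE -ltnS prednK.
Qed.

Lemma pow_ideal_socle f g : I f -> (g * f)@_socle_mnm = 0.
Proof. by move=> /pow_idealMl; apply; rewrite box_socle lepm_refl. Qed.

(* The socle coefficient makes the quotient algebra a Poincare duality algebra. *)
Lemma pow_ideal_dual i f : f \is i.-homog ->
  (forall m, (mdeg m + i)%N = mdeg socle_mnm -> ('X_[m] * f)@_socle_mnm = 0) ->
  I f.
Proof.
move=> Hf H m; rewrite box_socle => le_m.
have [mi|mi] := eqVneq (mdeg m) i; last exact: dhomog_nemf_coeff Hf mi.
have := H (socle_mnm - m)%MM.
rewrite mulrC mcoeffMX_le lem_subr; have E := submK le_m.
have -> : (socle_mnm - (socle_mnm - m) = m)%MM.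
  by rewrite -{1}E addmC addmK.
by apply; rewrite -mi -mdegD E.
Qed.

(** A monomial of degree [i.+2] is a variable times one of degree [i.+1], and a lift of the latter
    can be multiplied by that variable. *)
Lemma mult_surjectiveS i : mult_surjective d l i -> mult_surjective d l i.+1.
Proof.
move=> Hs g Hg.
pose hit h := exists2 f, f \is i.+1.-homog & I (h - l * f).
suff [f Hf HI] : hit g by exists f => //; apply/mci_idealP.
have hit0 : hit 0 by exists 0; rewrite ?rpred0 // mulr0 subr0; apply: pow_ideal0.
have hitD h1 h2 : hit h1 -> hit h2 -> hit (h1 + h2).
  move=> [f1 Hf1 H1] [f2 Hf2 H2]; exists (f1 + f2); first exact: rpredD.
  have -> : h1 + h2 - l * (f1 + f2) = (h1 - l * f1) + (h2 - l * f2) by ring.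
  exact: pow_idealD.
rewrite (mpolyE g) big_seq; apply: big_ind => // m.
move/dhomogP: (Hg) => Hm /Hm /= mi.
have [j mj] : exists j, m j != 0%N.
  apply/existsP; apply: contra_eqT mi => /existsPn H.
  by rewrite mdegE big1 // => j _; apply/eqP; rewrite -[_ == _]negbK H.
have Ej : (m - U_(j) + U_(j))%MM = m by apply: submK; rewrite lep1mP.
have [|f Hf /mci_idealP HI] := Hs 'X_[m - U_(j)].
  by rewrite dhomogX /= -(eqn_add2r (mdeg U_(j)%MM)) -mdegD Ej mi mdeg1 addn1.
exists (g@_m *: ('X_j * f)).
  by rewrite rpredZ // -add1n dhomogM // dhomogX /= mdeg1.
rewrite -Ej mpolyXD -scalerAr -scalerBr; apply: pow_idealZ.
have -> : 'X_[m - U_(j)] * 'X_j - l * ('X_j * f) = 'X_j * ('X_[m - U_(j)] - l * f).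
  by ring.
exact: pow_idealMl.
Qed.

Lemma mult_surjective_le i j : (i <= j)%N ->
  mult_surjective d l i -> mult_surjective d l j.
Proof.
move=> /subnK <- Hs; elim: (j - i)%N => [//|e IH].
exact: mult_surjectiveS.
Qed.

Lemma dual_mult_injective i j : (i + j).+1 = mdeg socle_mnm ->
  mult_surjective d l j -> mult_injective d l i.
Proof.
move=> Es Hs f Hf /mci_idealP Hlf; apply/mci_idealP.
apply: (pow_ideal_dual Hf) => m Em.
have [|f' Hf' /mci_idealP HI] := Hs 'X_[m].
  by rewrite dhomogX /= -(eqn_add2r i) Em -Es addSn addnC.
have -> : 'X_[m] * f = f * ('X_[m] - l * f') + f' * (l * f) by ring.
by rewrite mcoeffD !pow_ideal_socle ?addr0.
Qed.

(** The matrix [K] pairs degrees [i] and [j] through [l]. A left kernel vector is a form [h] with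
    [l * h] in [I], hence [h] in [I] by injectivity, so it pairs to 0 with [g]; [fredholm] then
    yields [f] such that [l * f] and [g] have the same pairings. *)
Lemma dual_mult_surjective i j : (i + j).+1 = mdeg socle_mnm ->
  mult_injective d l i -> mult_surjective d l j.
Proof.
move=> Es Hi g Hg; pose B := 'X_{1..n < (mdeg socle_mnm).+1}.
pose K (t s : B) : k := if (mdeg t == i) && (mdeg s == j)
  then ('X_[t] * l * 'X_[s])@_socle_mnm else 0.
pose v (t : B) : k := if mdeg t == i then ('X_[t] * g)@_socle_mnm else 0.
have [w Hw|z Hz] := @fredholm k B K v.
  pose h : {mpoly k[n]} := \sum_(t : B | mdeg t == i) w t *: 'X_[t].
  have h_homog : h \is i.-homog.
    by apply: rpred_sum => t /eqP ti; rewrite rpredZ // dhomogX /= ti.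
  have Hh : I h.
    apply/mci_idealP/Hi => //; apply/mci_idealP.
    have lh : l * h \is i.+1.-homog by rewrite -add1n dhomogM.
    apply: (pow_ideal_dual lh) => m Em.
    have lt_m : (mdeg m < (mdeg socle_mnm).+1)%N by rewrite ltnS -Em leq_addr.
    have mj : mdeg m = j by move: Em; rewrite -Es; lia.
    rewrite -(Hw (BMultinom lt_m)) mulrC /h mulr_sumr mulr_suml raddf_sum /=.
    rewrite big_mkcond; apply: eq_bigr => t _; rewrite /K /= mj eqxx andbT.
    case: ifP => _; last by rewrite mulr0.
    by rewrite -scalerAr -scalerAl mcoeffZ; congr (_ * (_ * _)@__); rewrite mulrC.
  have := pow_ideal_socle g Hh; rewrite /h mulr_sumr raddf_sum big_mkcond => E.
  rewrite -[RHS]E; apply: eq_bigr => t _ /=; rewrite /v.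
  by case: ifP => _; rewrite ?mulr0 // -scalerAr mcoeffZ mulrC [g * _]mulrC mulrC.
pose f : {mpoly k[n]} := \sum_(s : B | mdeg s == j) z s *: 'X_[s].
have f_homog : f \is j.-homog.
  by apply: rpred_sum => s /eqP sj; rewrite rpredZ // dhomogX /= sj.
exists f => //; apply/mci_idealP.
have glf : g - l * f \is j.+1.-homog by rewrite rpredB // -add1n dhomogM.
apply: (pow_ideal_dual glf) => m Em.
have mi : mdeg m = i by move: Em; rewrite -Es; lia.
have lt_m : (mdeg m < (mdeg socle_mnm).+1)%N by rewrite ltnS -Em leq_addr.
have := Hz (BMultinom lt_m); rewrite /v /= mi eqxx mulrBr mcoeffB => <-.
rewrite mulrA /f mulr_sumr raddf_sum [X in _ - X]big_mkcond.
apply/eqP; rewrite subr_eq0; apply/eqP; apply: eq_bigr => s _ /=.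
rewrite /K /= mi eqxx /=; case: ifP => _; last by rewrite mul0r.
by rewrite -scalerAr mcoeffZ mulrC.
Qed.

(** The dual degree [mdeg socle_mnm - i.+1] is at most [i], and surjectivity propagates upwards from
    it. From the socle degree on, the target is zero. *)
Lemma mult_injective_surjective i : (mdeg socle_mnm <= i.*2)%N ->
  mult_injective d l i -> mult_surjective d l i.
Proof.
move=> le_s Hi; have [lt_i|ge_i] := ltnP i (mdeg socle_mnm); last first.
  move=> g Hg; exists 0; rewrite ?rpred0 // mulr0 subr0; apply/mci_idealP.
  move=> m; rewrite box_socle => /submK E.
  apply: dhomog_nemf_coeff Hg _; rewrite ltn_eqF // ltnS.
  by apply: leq_trans ge_i; rewrite -E mdegD leq_addl.
apply: (@mult_surjective_le (mdeg socle_mnm - i.+1)); first by lia.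
by apply: dual_mult_surjective Hi; lia.
Qed.

Lemma mult_surjective_injective i : (i.+1.*2 <= mdeg socle_mnm)%N ->
  mult_surjective d l i -> mult_injective d l i.
Proof.
move=> le_s Hs; apply: (@dual_mult_injective i (mdeg socle_mnm - i.+1)); first by lia.
by apply: mult_surjective_le Hs; lia.
Qed.

End Duality.

(** * Translation to two distinguished variables *)

Section TwoVariables.
Variables (k : fieldType) (n : nat) (d D : nat -> nat) (S : {set 'I_n}).
Variables (x y : 'I_n).
Hypothesis S_or : forall i, [|| i \in S, i == x | i == y].
Hypothesis D_S : forall i, i \in S -> D i = d i.
Implicit Types (f : {mpoly k[n]}) (m : 'X_{1..n}).

(** Keeping [D] apart from [d] lets both algebras share the same [J]. *)
Lemma mci_ideal_two f : mci_ideal D f <-> pow_ideal2 d S x y (D x) (D y) f.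
Proof.
split=> [/mci_idealP Hf m /forall_inP B mx my|Hf]; last first.
  apply/mci_idealP => m /forall_inP B; apply: Hf; rewrite ?B ?inE //.
  by apply/forall_inP => i iS; rewrite -D_S // B ?inE.
apply: Hf; apply/forall_inP => i _.
by case/or3P: (S_or i) => [iS|/eqP ->|/eqP ->] //; rewrite D_S // B.
Qed.

Lemma mult_injective_two i :
  mult_injective D (@lform k n (fun=> 1)) i <-> inj2 k d S x y (D x) (D y) i.
Proof.
by split=> Hi f Hf /mci_ideal_two Hlf; apply/mci_ideal_two/Hi.
Qed.

Lemma mult_surjective_two i :
  mult_surjective D (@lform k n (fun=> 1)) i <-> surj2 k d S x y (D x) (D y) i.
Proof.
by split=> Hs g Hg; have [f Hf Hgf] := Hs g Hg; exists f => //; apply/mci_ideal_two.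
Qed.

Lemma has_WLP_two : has_WLP k n D <->
  forall i, inj2 k d S x y (D x) (D y) i \/ surj2 k d S x y (D x) (D y) i.
Proof.
rewrite has_WLP_lform; split=> H i; move: (H i).
  by rewrite mult_injective_two mult_surjective_two.
by rewrite -mult_injective_two -mult_surjective_two.
Qed.

End TwoVariables.

Theorem theorem4p8 (k : fieldType) (p : nat) (n : nat) (d : nat -> nat)
    (a : nat) :
  prime p -> p \in [pchar k] ->
  (2 <= n)%N ->
  (forall i, (i < n)%N -> (0 < d i)%N) ->
  (0 < a)%N ->
  (forall i, (i < n - 2)%N -> (d i <= p ^ a)%N) ->
  (forall b : nat, (0 < b)%N -> has_WLP k n (expB n d p a b) -> has_WLP k n d)
  /\
  ((\sum_(0 <= i < n - 2) (d i - 1) <= d (n - 2) + d (n - 1))%N ->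
   forall b : nat, (0 < b)%N -> (has_WLP k n d <-> has_WLP k n (expB n d p a b))).
Proof.
move=> _ pk; case: n => [|[|r]] // _ d_gt0 _ le_d.
rewrite subn1 /= in le_d *; have Er : (r.+2 - 2 = r)%N by rewrite !subSS subn0.
rewrite Er in le_d *.
pose x : 'I_r.+2 := widen_ord (leqnSn _) ord_max; pose y : 'I_r.+2 := ord_max.
pose S : {set 'I_r.+2} := [set i : 'I_r.+2 | (i < r)%N].
have S_or i : [|| i \in S, i == x | i == y].
  by rewrite inE -!val_eqE /=; have := ltn_ord i; lia.
have xS : x \notin S by rewrite inE /= ltnn.
have yS : y \notin S by rewrite inE /= ltnNge leqnSn.
have yx : y != x by rewrite -val_eqE /=; lia.
have WA := @has_WLP_two k _ d d S x y S_or (fun _ _ => erefl).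
have WB b := @has_WLP_two k _ d (expB r.+2 d p a b) S x y S_or.
have Bx b : expB r.+2 d p a b x = (d r + b * p ^ a)%N by rewrite /expB Er /= ltnn.
have By b : expB r.+2 d p a b y = (d r.+1 + b * p ^ a)%N.
  by rewrite /expB Er /= ltnNge leqnSn.
have {}WB b : has_WLP k r.+2 (expB r.+2 d p a b) <-> forall i,
    inj2 k d S x y (d r + b * p ^ a) (d r.+1 + b * p ^ a) i \/
    surj2 k d S x y (d r + b * p ^ a) (d r.+1 + b * p ^ a) i.
  by rewrite WB ?Bx ?By // => i; rewrite inE /expB Er => ->.
have eps0 b : ((-1) ^+ b : {mpoly k[r.+2]}) \is 0.-homog.
  by rewrite -[X in X.-homog](mul0n b) dhomogMn // rpredN dhomog1.
have eps2 b : (-1) ^+ b * (-1) ^+ b = 1 :> {mpoly k[r.+2]}.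
  by rewrite -expr2 sqrr_sign.
have Hfr b := @frobenius_lform k _ d S x y p a b pk yx xS yS.
have {}Hfr b : exists g : {mpoly k[r.+2]}, pow_ideal d S
    ('X_y ^+ (b * p ^ a) - (-1) ^+ b * 'X_x ^+ (b * p ^ a) - lform (fun=> 1) * g).
  apply: Hfr => i; last by rewrite inE => /le_d.
  by move=> /negPf ix /negPf iy; have := S_or i; rewrite ix iy !orbF.
have part1 b : has_WLP k r.+2 (expB r.+2 d p a b) -> has_WLP k r.+2 d.
  rewrite WA WB => H i; have [g0 YX] := Hfr b.
  have [Hi|Hs] := H (i + b * p ^ a)%N.
    by left; apply: (inj2_unshift yS yx YX Hi).
  by right; apply: (surj2_unshift xS yS yx (eps2 b) YX Hs).
split=> [b _|le_t b _]; first exact: part1.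
split; last exact: part1.
set t := (\sum_(_ <= i < _) _)%N in le_t.
rewrite big_mkord in t le_t *.
have dr : (0 < d r)%N by apply: d_gt0.
have dr1 : (0 < d r.+1)%N by apply: d_gt0.
have Es : mdeg (socle_mnm r.+2 d) = (t + (d r).-1 + (d r.+1).-1)%N.
  rewrite mdegE !big_ord_recr /= !mnmE /=; congr (_ + _ + _)%N.
  by apply: eq_bigr => i _; rewrite mnmE subn1.
have l_homog := lform_homog (fun=> 1 : k) (n := r.+2).
rewrite WA WB => H i; have [g0 YX] := Hfr b.
(* Below [b * p ^ a], positivity of [d r] and [d r.+1] puts [i.+1] strictly below both enlarged
   exponents. *)
have [lt_i|ge_i] := ltnP i (b * p ^ a).
  by left; apply: (inj2_small yS); lia.
rewrite -(subnK ge_i); move: (i - _)%N => j {i ge_i}.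
have shift_inj : (j.+1 < d r + d r.+1)%N -> inj2 k d S x y (d r) (d r.+1) j ->
    inj2 k d S x y (d r + b * p ^ a) (d r.+1 + b * p ^ a) (j + b * p ^ a).
  exact: (inj2_shift xS yS yx (eps0 b) (eps2 b) YX).
have shift_surj : (t <= j.+1)%N -> surj2 k d S x y (d r) (d r.+1) j ->
    surj2 k d S x y (d r + b * p ^ a) (d r.+1 + b * p ^ a) (j + b * p ^ a).
  apply: (surj2_shift YX) => m /forall_inP Bm mx.
  rewrite mdegE !big_ord_recr /= -/x -/y mx addn0 leq_add2r.
  have d_gt0' (i : 'I_r) : (0 < d i)%N by apply: d_gt0; have := ltn_ord i; lia.
  apply: leq_sum => i _; rewrite subn1 -ltnS prednK //.
  by apply: Bm; rewrite inE /=.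
have bridgeI := @mult_injective_two k _ d d S x y S_or (fun _ _ => erefl) j.
have bridgeS := @mult_surjective_two k _ d d S x y S_or (fun _ _ => erefl) j.
case: (H j) => [Hi|Hs].
  have [lt_j|ge_j] := ltnP j.+1 (d r + d r.+1); first by left; apply: shift_inj.
  (* Here [t <= d r + d r.+1 <= j.+1], so the socle degree [t + d r + d r.+1 - 2] is at most [2 * j]
     and duality gives surjectivity. *)
  right; apply: shift_surj; first exact: leq_trans ge_j.
  by apply/bridgeS/mult_injective_surjective/bridgeI => //; rewrite Es; lia.
have [le_j|gt_j] := leqP t j.+1; first by right; apply: shift_surj.
(* Here [j.+1 < t <= d r + d r.+1], so the socle degree is at least [2 * j.+1] and duality gives
   injectivity. *)
left; apply: shift_inj; first exact: leq_trans gt_j le_t.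
by apply/bridgeI/mult_surjective_injective/bridgeS => //; rewrite Es; lia.
Qed.
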